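(* Let $T=(V,E)$ be a combinatorial tree and let $i,j\in V$ be fixed with $i\neq j$. Then the Lin-Lu-Yau curvature is $$\kappa^{\mathsf{lly}}_{ij}=\frac{2}{\Delta(i,j)}\left(\frac{1}{\mathrm{d}(i)}+\frac{1}{\mathrm{d}(j)}-1\right).$$
   Context: A tree is a finite, simple, connected, acyclic graph; a combinatorial tree is a tree with all edge weights equal to one. Write $V=\{1,\dots,n\}$, $i\sim j$ if $\{i,j\}\in E$, and $\mathrm{d}(i)$ for the degree of $i$ (number of incident edges). $\Delta(i,j)$ is the shortest path distance (number of edges in a shortest path). For $\alpha\in[0,1)$ and $i\in V$, the $\alpha$-lazy random walk measure $m_i^{(\alpha)}$ is the probability measure on $V$ with $m_i^{(\alpha)}(i)=\alpha$, $m_i^{(\alpha)}(x)=(1-\alpha)/\mathrm{d}(i)$ if $x\sim i$, and $m_i^{(\alpha)}(x)=0$ otherwise. For probability measures $\mu,\nu$ on $V$, $$\mathsf{W}_1(\mu,\nu)=\inf\Big\{\sum_{i,j\in V}\pi_{ij}\Delta(i,j):\ \pi\in\mathbb{R}^{n\times n},\ \pi_{ij}\ge 0,\ \mathbf{1}^T\pi=\mu^T,\ \pi\mathbf{1}=\nu\Big\},$$ where $\mathbf 1$ is the all-ones vector. For $i\ne j$, the Ollivier-Ricci curvature is $\kappa^{\mathsf{or},\alpha}_{ij}=1-\mathsf{W}_1(m_i^{(\alpha)},m_j^{(\alpha)})/\Delta(i,j)$, and the Lin-Lu-Yau curvature is $\kappa^{\mathsf{lly}}_{ij}=\lim_{\alpha\to1^-}\kappa^{\mathsf{or},\alpha}_{ij}/(1-\alpha)$.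 *)

(* Defs.v *)
From mathcomp Require Import all_boot all_order all_algebra.
From mathcomp Require Import all_classical all_reals all_analysis.

Set Implicit Arguments.
Unset Strict Implicit.
Unset Printing Implicit Defensive.

Import Order.TTheory GRing.Theory Num.Theory.
Import numFieldNormedType.Exports.

Local Open Scope classical_set_scope.
Local Open Scope ring_scope.

Section Graph.
Variables (n : nat) (e : rel 'I_n).

Definition simple_graph : Prop := symmetric e /\ irreflexive e.

Definition graph_connected : Prop := forall i j : 'I_n, connect e i j.

(* [ucycle e c] also holds for an edge traversed back and forth ([size c = 2]),
   which is not a cycle of a graph. *)
Definition acyclic : Prop := forall c : seq 'I_n, ucycle e c -> (size c <= 2)%N.

Definition is_tree : Prop := [/\ simple_graph, graph_connected & acyclic].

Definition degree (i : 'I_n) : nat := #|[set j : 'I_n | e i j]%SET|.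

Definition has_path (i j : 'I_n) (k : nat) : bool :=
  [exists p : k.-tuple 'I_n, [&& path.path e i p, uniq (i :: p) & last i p == j]].

(* [find] over [0, ..., n - 1] returns the least [k] with [has_path i j k]:
   simple paths have at most [n - 1] edges.  The value is [n] if there is no
   path, which does not occur in a connected graph. *)
Definition graph_dist (i j : 'I_n) : nat := find (has_path i j) (iota 0 n).

End Graph.

Section Curvature.
Variables (R : realType) (n : nat) (e : rel 'I_n).

Definition lazy_walk (a : R) (i : 'I_n) : 'cV[R]_n :=
  \col_x (if x == i then a
          else if e i x then (1 - a) / (degree e i)%:R else 0).

Definition coupling (mu nu : 'cV[R]_n) (pi : 'M[R]_n) : Prop :=
  [/\ forall i j, 0 <= pi i j,
      (const_mx 1 : 'rV[R]_n) *m pi = mu^T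
    & pi *m (const_mx 1 : 'cV[R]_n) = nu].

Definition transport_cost (pi : 'M[R]_n) : R :=
  \sum_i \sum_j pi i j * (graph_dist e i j)%:R.

Definition wasserstein1 (mu nu : 'cV[R]_n) : R :=
  inf [set transport_cost pi | pi in [set pi | coupling mu nu pi]].

Definition or_curvature (a : R) (i j : 'I_n) : R :=
  1 - wasserstein1 (lazy_walk a i) (lazy_walk a j) / (graph_dist e i j)%:R.

Definition lly_quotient (i j : 'I_n) (a : R) : R :=
  or_curvature a i j / (1 - a).

(* [lim] is total; it is the limit only when [lly_quotient i j] converges. *)
Definition lly_curvature (i j : 'I_n) : R :=
  lim (lly_quotient i j a @[a --> (1 : R)^'-]).

End Curvature.

Arguments lly_curvature R {n} e i j.

(* Main.v *)
Require Import Defs.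
From mathcomp Require Import all_boot all_order all_algebra.
From mathcomp Require Import all_classical all_reals all_analysis.
From mathcomp Require Import ring lra zify.
Import Order.TTheory GRing.Theory Num.Theory.
Import numFieldNormedType.Exports.

Local Open Scope classical_set_scope.
Local Open Scope ring_scope.

(** Write [D] for the distance from [i] to [j], [t := 1 - a] for the probability
    of leaving the current vertex, and [S := 2 - 2 / deg i - 2 / deg j].  For
    [0 <= a <= 1] the distance [W] between the two lazy walks satisfies
    [[
      D + t * S <= W <= D + t * S + t ^+ 2 * (2 / deg i + 2 / deg j),
    ]]
    so [(1 - W / D) / t] is squeezed to [- S / D] as [t] tends to [0].

    Both bounds rest on one property of trees: exactly one neighbour of [i] is
    closer to [j], and all the others are at distance [D + 1] from [j]
    ([tree_neighbour_dist]).  Hence the mean distance to [j] after one step of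
    the walk from [i] is [D + t * (1 - 2 / deg i)] ([lazy_walk_sum_dist]).

    The lower bound is the easy half of Kantorovich duality
    ([wasserstein1_ge_potential]).  Let [p] be the neighbour of [i] towards [j].
    Deleting the edge [i p] disconnects the tree, and the potential is the
    distance to [i], counted positively on the side of [i] and negatively on the
    side of [p] ([signed_dist]).  It is 1-Lipschitz because only the edge [i p]
    joins the two sides.  Its mean is [t * (1 - 2 / deg i)] under the walk from
    [i], and minus the mean distance to [i] under the walk from [j], because
    [j] and its neighbours lie on the side of [p] or at [i] itself.

    The upper bound is the cost of the product coupling
    ([wasserstein1_le_product]).  This coupling is not optimal in general: when
    [i] and [j] are adjacent, it exchanges some mass across the edge [i j].  Only
    the event that both walkers move can be wasteful, and it has probability
    [t ^+ 2], so the crude bound [D + 2] on the distance after two moves is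
    enough to first order. *)

(** * Paths and distance in a graph *)

Section GraphDistance.
Variables (n : nat) (e : rel 'I_n).

Local Notation d := (graph_dist e).

(** The definition of [graph_dist] only looks at simple paths; cutting out loops
    shows that arbitrary walks are no shorter. *)
Lemma graph_dist_le_path x s : path.path e x s -> (d x (last x s) <= size s)%N.
Proof.
case/shortenP=> p p_path p_uniq p_sub.
have p_lt : (size p < n)%N.
  rewrite -[X in (_ < X)%N](card_ord n) -[(size p).+1]/(size (x :: p)).
  by rewrite -(card_uniqP p_uniq) max_card.
have p_le : (size p <= size s)%N.
  by apply: uniq_leq_size p_sub; case/andP: p_uniq.
apply: leq_trans p_le; rewrite leqNgt; apply/negP => /(before_find 0%N).
rewrite nth_iota // add0n => /existsP[]; exists (in_tuple p).
by rewrite /= p_path eqxx andbT.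
Qed.

Lemma graph_dist_self x : d x x = 0%N.
Proof. by apply/eqP; rewrite -leqn0 (@graph_dist_le_path x [::]). Qed.

Lemma graph_dist_edge x y : e x y -> (d x y <= 1)%N.
Proof. by move=> exy; apply: (@graph_dist_le_path x [:: y]); rewrite /= exy. Qed.

Hypothesis conn_e : graph_connected e.

Lemma graph_dist_path x y :
  exists s, [/\ path.path e x s, last x s = y & size s = d x y].
Proof.
have has_xy : has (has_path e x y) (iota 0 n).
  case/connectP: (conn_e x y) => s /shortenP[p p_path p_uniq _] ->.
  apply/hasP; exists (size p).
    rewrite mem_iota add0n /= -[X in (_ < X)%N](card_ord n).
    rewrite -[(size p).+1]/(size (x :: p)).
    by rewrite -(card_uniqP p_uniq) max_card.
  by apply/existsP; exists (in_tuple p); rewrite p_path p_uniq eqxx.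
have d_lt : (d x y < n)%N by move: has_xy; rewrite has_find size_iota.
have := nth_find 0%N has_xy; rewrite -/(d x y) nth_iota // add0n.
case/existsP=> p /and3P[p_path _ /eqP p_last].
by exists p; rewrite size_tuple.
Qed.

Lemma graph_dist_triangle x y z : (d x z <= d x y + d y z)%N.
Proof.
have [s [s_path s_last <-]] := graph_dist_path x y.
have [t [t_path t_last <-]] := graph_dist_path y z.
rewrite -size_cat -t_last -s_last -last_cat; apply: graph_dist_le_path.
by rewrite cat_path s_path s_last.
Qed.

Lemma graph_dist_eq0 x y : d x y = 0%N -> x = y.
Proof. by have [[|? ?] [_ /= ? <-]] := graph_dist_path x y. Qed.

(** The first edge of a shortest path. *)
Lemma edge_towards x y : x <> y -> exists2 p, e x p & d x y = (d p y).+1.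
Proof.
have [[|p s] [/= xs_path xs_last xs_size]] := graph_dist_path x y => // _.
case/andP: xs_path => exp ps_path; exists p => //; apply/eqP.
rewrite eqn_leq -{2}xs_size ltnS -xs_last graph_dist_le_path // andbT.
rewrite xs_last -add1n; apply: leq_trans (graph_dist_triangle x p y) _.
by rewrite leq_add2r graph_dist_edge.
Qed.

Lemma lipschitz_graph_dist (R : realDomainType) (h : 'I_n -> R) :
  (forall x y, e x y -> h x - h y <= 1) ->
  forall x y, h x - h y <= (d x y)%:R.
Proof.
move=> h_edge x y; have [s [s_path <- <-]] := graph_dist_path x y.
elim: s x s_path => [|z s IHs] x /=; first by rewrite subrr.
case/andP=> /h_edge xz /IHs zs; rewrite -natr1; lra.
Qed.

Hypothesis sym_e : symmetric e.

Lemma graph_distC x y : d x y = d y x.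
Proof.
suff le_d u v : (d u v <= d v u)%N by apply/eqP; rewrite eqn_leq !le_d.
have [s [s_path s_last <-]] := graph_dist_path v u.
have rev_s_path : path.path e (last v s) (rev (belast v s)).
  by rewrite rev_path (eq_path (e' := e)) // => a b; rewrite /= sym_e.
have := graph_dist_le_path _ _ rev_s_path.
rewrite size_rev size_belast s_last; congr (d _ _ <= _)%N.
by case: s s_last {s_path rev_s_path} => [|z s] //= _; rewrite /rev /= catrevE last_cat.
Qed.

End GraphDistance.

(** * Cutting a tree at an edge *)

Section TreeCut.
Variables (n : nat) (e : rel 'I_n).
Hypothesis tree_e : is_tree e.

Local Notation d := (graph_dist e).

Let sym_e : symmetric e. Proof. by case: tree_e => -[]. Qed.
Let irr_e : irreflexive e. Proof. by case: tree_e => -[]. Qed.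
Let conn_e : graph_connected e. Proof. by case: tree_e. Qed.

Definition delete_edge (i p : 'I_n) : rel 'I_n :=
  [rel x y | [&& e x y, (x, y) != (i, p) & (x, y) != (p, i)]].

Definition cut_side (i p : 'I_n) : pred 'I_n := connect (delete_edge i p) i.

(** A simple path from [i] to [p] avoiding the edge [i p] has at least two edges;
    closing it up with that edge gives a cycle of length at least three. *)
Lemma tree_edge_bridge i p : e i p -> ~~ cut_side i p p.
Proof.
move=> eip; apply/negP => /connectP[s /shortenP[c c_path c_uniq _] c_last].
have del_sub : subrel (delete_edge i p) e by move=> x y /and3P[].
have c_cycle : ucycle e (i :: c).
  rewrite /ucycle c_uniq andbT /= rcons_path (sub_path del_sub c_path).
  by rewrite -c_last sym_e.
have acyc : acyclic e by case: tree_e.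
have {c_cycle c_uniq} := acyc _ c_cycle.
case: c c_path c_last => [|x [|//]] /=.
  by move=> _ ip; move: eip; rewrite ip irr_e.
by rewrite andbT => /and3P[_ ne _] px; rewrite px eqxx in ne.
Qed.

Lemma cut_side_crossing i p x y :
  e i p -> e x y -> cut_side i p x -> ~~ cut_side i p y -> x = i /\ y = p.
Proof.
move=> eip exy x_in y_out.
have [/eqP[-> ->]//|xy_ip] := boolP ((x, y) == (i, p)).
have [/eqP[xp yi]|xy_pi] := boolP ((x, y) == (p, i)).
  by move: x_in; rewrite xp (negPf (tree_edge_bridge _ _ eip)).
case/negP: y_out; apply: (connect_trans x_in); apply: connect1.
by apply/and3P; split.
Qed.

(** A shortest path from [p] to [j] cannot visit [i], which is farther from [j]
    than [p]; so it survives the deletion of the edge [i p]. *)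
Lemma target_beyond_cut i j p :
  e i p -> d i j = (d p j).+1 -> ~~ cut_side i p j.
Proof.
move=> eip dij; have [s [s_path s_last s_size]] := graph_dist_path _ _ conn_e p j.
have i_notin : i \notin p :: s.
  apply/negP; rewrite inE => /orP[/eqP ip|]; first by move: eip; rewrite ip irr_e.
  move=> i_in; case: (path.splitPr i_in) s_path s_last s_size => s1 s2 s_path s_last s_size.
  move: s_path s_last; rewrite cat_path last_cat /= => /and3P[_ _ s2_path] s2_last.
  have := graph_dist_le_path _ _ _ _ s2_path; rewrite s2_last dij -s_size size_cat /=.
  lia.
have path_del q t : path.path e q t -> i \notin q :: t ->
    path.path (delete_edge i p) q t.
  elim: t q => //= y t IHt q /andP[eqy yt_path].
  rewrite !inE !negb_or => /and3P[iq iy i_t].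
  apply/andP; split; last by apply: IHt; rewrite // inE negb_or iy.
  apply/and3P; split; rewrite // xpair_eqE negb_and; first by rewrite eq_sym iq.
  by rewrite orbC eq_sym iy.
have pj : connect (delete_edge i p) p j.
  by apply/connectP; exists s; rewrite // path_del.
have del_sym : symmetric (delete_edge i p).
  suff flip x y : delete_edge i p x y -> delete_edge i p y x.
    by move=> x y; apply/idP/idP; apply: flip.
  case/and3P=> exy xy_ip xy_pi; apply/and3P; rewrite sym_e; split=> //.
    by apply: contra xy_pi => /eqP[-> ->].
  by apply: contra xy_ip => /eqP[-> ->].
apply: contra (tree_edge_bridge _ _ eip) => ij.
apply: connect_trans ij _.
by rewrite (sym_connect_sym del_sym).
Qed.


(** The value [y = i] does occur, when [i] and [j] are adjacent.  It is harmless
    for the signed distance below, which vanishes at [i]. *)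
Lemma neighbour_beyond_cut i p j : e i p -> d i j = (d p j).+1 ->
  forall y, e j y -> cut_side i p y -> y = i.
Proof.
move=> eip dij y ejy y_in.
have eyj : e y j by rewrite sym_e.
by case: (cut_side_crossing _ _ _ _ eip eyj y_in (target_beyond_cut _ _ _ eip dij)).
Qed.

Section SignedDistance.
Variables (R : realDomainType) (i p : 'I_n).
Hypothesis eip : e i p.

(** The Kantorovich potential, a 1-Lipschitz function that is monotone along the
    whole stretch from the neighbours of [i] to those of [j].  Its values are
    integers; the codomain is a parameter because [tree_neighbour_dist] uses
    them in [int], and the transport bounds use them in the reals. *)
Definition signed_dist (x : 'I_n) : R :=
  if cut_side i p x then (d x i)%:R else - (d x i)%:R.

Lemma signed_dist_edge x y : e x y -> signed_dist x - signed_dist y <= 1.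
Proof.
move=> exy; have dxy : (d x y <= 1)%N := graph_dist_edge _ _ _ _ exy.
have le_dist u v : (d u v <= 1)%N -> (d u i)%:R <= (d v i)%:R + 1 :> R.
  move=> duv; rewrite natr1 ler_nat.
  by have := graph_dist_triangle _ _ conn_e u v i; lia.
have dyx : (d y x <= 1)%N by rewrite graph_distC.
have [dxi_ge0 dyi_ge0] : (0 : R) <= (d x i)%:R /\ (0 : R) <= (d y i)%:R.
  by rewrite !ler0n.
rewrite /signed_dist; case: ifPn => x_in; case: ifPn => y_in.
- by have := le_dist _ _ dxy; lra.
(* The only edge that leaves the side of [i] is [i p]; there the potential drops
   from [0] to [- d p i]. *)
- have [-> ->] := cut_side_crossing _ _ _ _ eip exy x_in y_in.
  rewrite graph_dist_self mulr0n add0r opprK (ler_nat R _ 1).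
  by rewrite graph_dist_edge // sym_e.
- lra.
- by have := le_dist _ _ dyx; lra.
Qed.

Lemma signed_dist_lipschitz x y : signed_dist x - signed_dist y <= (d x y)%:R.
Proof. exact: lipschitz_graph_dist conn_e _ signed_dist signed_dist_edge x y. Qed.

Lemma signed_dist_neighbour x : e i x -> signed_dist x = if x == p then -1 else 1.
Proof.
move=> eix; have dxi : d x i = 1%N.
  have exi : e x i by rewrite sym_e.
  have := graph_dist_edge _ _ _ _ exi; case: (d x i) (graph_dist_eq0 _ _ conn_e x i).
    by move=> /(_ erefl) xi; move: eix; rewrite xi irr_e.
  by case.
rewrite /signed_dist dxi; have [->|xp] := eqVneq x p.
  by rewrite (negPf (tree_edge_bridge _ _ eip)).
suff -> : cut_side i p x by [].
apply: connect1; apply/and3P; split; rewrite // xpair_eqE negb_and ?xp ?orbT //.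
by apply/orP; left; apply: contraTneq eip => ->; rewrite irr_e.
Qed.

End SignedDistance.

(** If [x] is a neighbour of [i] other than [p], then [signed_dist] is [1] at [x]
    and [- d i j] at [j], so the Lipschitz bound gives [d x j >= d i j + 1]. *)
Lemma tree_neighbour_dist i j : i <> j ->
  exists p, [/\ e i p, d i j = (d p j).+1
    & forall x, e i x -> x != p -> d x j = (d i j).+1].
Proof.
move=> /(edge_towards _ _ conn_e)[p eip dij]; exists p; split=> // x eix xp.
have exi : e x i by rewrite sym_e.
apply/eqP; rewrite eqn_leq; apply/andP; split.
  have := graph_dist_triangle _ _ conn_e x i j.
  by have := graph_dist_edge _ _ _ _ exi; lia.
have := signed_dist_lipschitz int i p eip x j.
rewrite signed_dist_neighbour // (negPf xp) /signed_dist.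
rewrite (negPf (target_beyond_cut _ _ _ eip dij)) opprK addrC natr1 ler_nat.
by rewrite graph_distC.
Qed.

End TreeCut.

(** * Transport bounds *)

Section Transport.
Variables (R : realType) (n : nat) (e : rel 'I_n).

Local Notation d := (graph_dist e).
Local Notation mass mu := (\sum_x (mu : 'cV[R]_n) x 0).

Lemma coupling_colsum (mu nu : 'cV[R]_n) pi : coupling mu nu pi ->
  forall y, \sum_x pi x y = mu y 0.
Proof.
case=> _ /matrixP col_mu _ y; have := col_mu 0 y; rewrite !mxE => <-.
by apply: eq_bigr => x _; rewrite mxE mul1r.
Qed.

Lemma coupling_rowsum (mu nu : 'cV[R]_n) pi : coupling mu nu pi ->
  forall x, \sum_y pi x y = nu x 0.
Proof.
case=> _ _ /matrixP row_nu x; have := row_nu x 0; rewrite !mxE => <-.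
by apply: eq_bigr => y _; rewrite mxE mulr1.
Qed.

(** In [coupling mu nu pi] the columns of [pi] sum to [mu] and its rows to [nu],
    hence the order of the factors. *)
Lemma coupling_product (mu nu : 'cV[R]_n) :
  (forall x, 0 <= mu x 0) -> (forall x, 0 <= nu x 0) ->
  mass mu = 1 -> mass nu = 1 -> coupling mu nu (nu *m mu^T).
Proof.
move=> mu_ge0 nu_ge0 mu1 nu1; split.
- by move=> x y; rewrite mxE big_ord1 mxE mulr_ge0.
- rewrite mulmxA; suff -> : const_mx 1 *m nu = 1%:M by rewrite mul1mx.
  apply/matrixP => x y; rewrite !ord1 !mxE; apply: etrans nu1.
  by apply: eq_bigr => z _; rewrite mxE mul1r.
- rewrite -mulmxA; suff -> : mu^T *m const_mx 1 = 1%:M by rewrite mulmx1.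
  apply/matrixP => x y; rewrite !ord1 !mxE; apply: etrans mu1.
  by apply: eq_bigr => z _; rewrite !mxE mulr1.
Qed.

(** Weak Kantorovich duality: integrate [h y - h x <= d x y] against [pi]. *)
Lemma transport_cost_ge_potential (mu nu : 'cV[R]_n) pi (h : 'I_n -> R) :
  coupling mu nu pi -> (forall x y, h y - h x <= (d x y)%:R) ->
  \sum_x mu x 0 * h x - \sum_x nu x 0 * h x <= transport_cost e pi.
Proof.
move=> pi_cpl h_lip.
have -> : \sum_x mu x 0 * h x = \sum_x \sum_y pi x y * h y.
  rewrite exchange_big; apply: eq_bigr => y _.
  by rewrite -(coupling_colsum _ _ _ pi_cpl) mulr_suml.
have -> : \sum_x nu x 0 * h x = \sum_x \sum_y pi x y * h x.
  by apply: eq_bigr => x _; rewrite -(coupling_rowsum _ _ _ pi_cpl) mulr_suml.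
rewrite -sumrB; apply: ler_sum => x _; rewrite -sumrB; apply: ler_sum => y _.
by rewrite -mulrBr ler_wpM2l //; case: pi_cpl.
Qed.

Lemma wasserstein1_ge_potential (mu nu : 'cV[R]_n) (h : 'I_n -> R) :
  (forall x, 0 <= mu x 0) -> (forall x, 0 <= nu x 0) ->
  mass mu = 1 -> mass nu = 1 ->
  (forall x y, h y - h x <= (d x y)%:R) ->
  \sum_x mu x 0 * h x - \sum_x nu x 0 * h x <= wasserstein1 e mu nu.
Proof.
move=> mu_ge0 nu_ge0 mu1 nu1 h_lip; apply: lb_le_inf.
  exists (transport_cost e (nu *m mu^T)), (nu *m mu^T) => //=.
  exact: coupling_product.
by move=> _ [pi pi_cpl <-]; exact: transport_cost_ge_potential.
Qed.

Lemma wasserstein1_le_cost (mu nu : 'cV[R]_n) pi :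
  coupling mu nu pi -> wasserstein1 e mu nu <= transport_cost e pi.
Proof.
move=> pi_cpl; apply: ge_inf; last by exists pi.
exists 0 => _ [pi' [pi'_ge0 _ _] <-].
by apply: sumr_ge0 => x _; apply: sumr_ge0 => y _; rewrite mulr_ge0.
Qed.

Lemma wasserstein1_le_product (mu nu : 'cV[R]_n) :
  (forall x, 0 <= mu x 0) -> (forall x, 0 <= nu x 0) ->
  mass mu = 1 -> mass nu = 1 ->
  wasserstein1 e mu nu <= \sum_x nu x 0 * \sum_y mu y 0 * (d x y)%:R.
Proof.
move=> mu_ge0 nu_ge0 mu1 nu1.
apply: le_trans (wasserstein1_le_cost _ _ _ (coupling_product _ _ _ _ mu1 nu1)) _ => //.
apply: ler_sum => x _; rewrite mulr_sumr; apply: ler_sum => y _.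
by rewrite mulrA !mxE big_ord1 mxE.
Qed.

End Transport.

(** * One step of the lazy walk *)

Section LazyWalk.
Variables (R : realType) (n : nat) (e : rel 'I_n).

Lemma lazy_walk_sum (a : R) i (F : 'I_n -> R) : irreflexive e ->
  \sum_x lazy_walk e a i x 0 * F x =
    a * F i + (1 - a) / (degree e i)%:R * \sum_(x | e i x) F x.
Proof.
move=> irr_e; rewrite (bigD1 i) //= mxE eqxx; congr (_ + _).
rewrite mulr_sumr [RHS]big_mkcond [LHS]big_mkcond /=; apply: eq_bigr => x _.
rewrite mxE; have [->|xi] := eqVneq x i; first by rewrite irr_e.
by case: (e i x); rewrite ?mul0r.
Qed.

Lemma sum_neighbours_const i (c : R) :
  \sum_(x | e i x) c = (degree e i)%:R * c.
Proof.
rewrite /degree mulr_natl -sumr_const; apply: eq_bigl => x.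
by rewrite inE.
Qed.

Lemma lazy_walk_ge0 (a : R) i x : 0 <= a <= 1 -> 0 <= lazy_walk e a i x 0.
Proof.
case/andP=> a_ge0 a_le1; rewrite mxE; case: ifP => // _; case: ifP => // _.
by rewrite divr_ge0 // subr_ge0.
Qed.

Lemma lazy_walk_mass (a : R) i : irreflexive e -> (0 < degree e i)%N ->
  \sum_x lazy_walk e a i x 0 = 1.
Proof.
move=> irr_e deg_gt0.
under eq_bigr do rewrite -[lazy_walk _ _ _ _ _]mulr1.
rewrite (lazy_walk_sum _ _ (fun=> 1)) // sum_neighbours_const !mulr1.
by rewrite divfK ?pnatr_eq0 -?lt0n // subrKC.
Qed.

End LazyWalk.

(** * Lazy walks on a tree *)

Section TreeWasserstein.
Variables (R : realType) (n : nat) (e : rel 'I_n).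
Hypothesis tree_e : is_tree e.

Local Notation d := (graph_dist e).
Local Notation deg i := ((degree e i)%:R : R).

Let sym_e : symmetric e. Proof. by case: tree_e => -[]. Qed.
Let irr_e : irreflexive e. Proof. by case: tree_e => -[]. Qed.
Let conn_e : graph_connected e. Proof. by case: tree_e. Qed.

Lemma degree_gt0 i j : i <> j -> (0 < degree e i)%N.
Proof.
move=> /(edge_towards _ _ conn_e)[p eip _].
by apply/card_gt0P; exists p; rewrite inE.
Qed.

Lemma sum_neighbours_but_one i p (F : 'I_n -> R) (c : R) :
  e i p -> (forall x, e i x -> x != p -> F x = c) ->
  \sum_(x | e i x) F x = deg i * c + (F p - c).
Proof.
move=> eip Fc; rewrite -sum_neighbours_const (bigD1 p) //= [in RHS](bigD1 p) //=.
rewrite (eq_bigr (fun=> c)) => [|x /andP[eix xp]]; last exact: Fc.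
by ring.
Qed.

Lemma sum_neighbour_dist i j : i <> j ->
  \sum_(x | e i x) (d x j)%:R = deg i * ((d i j)%:R + 1) - 2.
Proof.
case/(tree_neighbour_dist _ _ tree_e)=> p [eip dij dxj].
rewrite (sum_neighbours_but_one i p _ ((d i j)%:R + 1)) // => [|x eix xp].
  by rewrite dij -natr1; ring.
by rewrite dxj // -natr1.
Qed.

Lemma sum_signed_dist i p : e i p ->
  \sum_(x | e i x) signed_dist n e R i p x = deg i - 2.
Proof.
move=> eip; rewrite (sum_neighbours_but_one i p _ 1) // => [|x eix xp].
  by rewrite signed_dist_neighbour // eqxx; ring.
by rewrite signed_dist_neighbour // (negPf xp).
Qed.

Lemma lazy_walk_sum_dist (a : R) i j : i <> j ->
  \sum_x lazy_walk e a i x 0 * (d x j)%:R =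
    (d i j)%:R + (1 - a) * (1 - 2 / deg i).
Proof.
move=> ij; rewrite lazy_walk_sum // sum_neighbour_dist //.
have deg_neq0 : deg i != 0 by rewrite pnatr_eq0 -lt0n (degree_gt0 i j).
by field.
Qed.

Lemma wasserstein1_lazy_walk_ge (a : R) i j : 0 <= a <= 1 -> i <> j ->
  (d i j)%:R + (1 - a) * (2 - 2 / deg i - 2 / deg j)
    <= wasserstein1 e (lazy_walk e a i) (lazy_walk e a j).
Proof.
move=> a01 ij; have ji : j <> i by move/esym.
have [p eip dij] := edge_towards _ _ conn_e _ _ ij.
pose h := signed_dist n e R i p.
have -> : (d i j)%:R + (1 - a) * (2 - 2 / deg i - 2 / deg j) =
    \sum_x lazy_walk e a i x 0 * h x - \sum_x lazy_walk e a j x 0 * h x.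
  have hj x : x = j \/ e j x -> h x = - (d x i)%:R.
    rewrite /h /signed_dist; case: ifPn => // x_in [xj|ejx].
      by move: x_in; rewrite xj (negPf (target_beyond_cut _ _ tree_e _ _ _ eip dij)).
    rewrite (neighbour_beyond_cut _ _ tree_e _ _ _ eip dij _ ejx x_in).
    by rewrite graph_dist_self mulr0n oppr0.
  have hi : h i = 0 by rewrite /h /signed_dist graph_dist_self mulr0n oppr0 if_same.
  have -> : \sum_x lazy_walk e a j x 0 * h x =
      - \sum_x lazy_walk e a j x 0 * (d x i)%:R.
    rewrite !lazy_walk_sum // hj; last by left.
    rewrite (eq_bigr (fun x => - (d x i)%:R)) => [|x ejx]; last by apply: hj; right.
    by rewrite sumrN; ring.
  rewrite lazy_walk_sum_dist // lazy_walk_sum // hi sum_signed_dist //.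
  rewrite (graph_distC _ _ conn_e sym_e j i).
  have deg_neq0 : deg i != 0 by rewrite pnatr_eq0 -lt0n (degree_gt0 i j).
  have degj_neq0 : deg j != 0 by rewrite pnatr_eq0 -lt0n (degree_gt0 j i).
  by field; apply/andP.
apply: wasserstein1_ge_potential.
- by move=> x; exact: lazy_walk_ge0.
- by move=> x; exact: lazy_walk_ge0.
- by apply: lazy_walk_mass => //; exact: degree_gt0 ij.
- by apply: lazy_walk_mass => //; exact: degree_gt0 ji.
move=> x y; rewrite (graph_distC _ _ conn_e sym_e).
exact: signed_dist_lipschitz.
Qed.

(** The excess over the lower bound comes from the pairs where both walkers move
    and [d i j + 2] is used for their distance. *)
Lemma wasserstein1_lazy_walk_le (a : R) i j : 0 <= a <= 1 -> i <> j ->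
  wasserstein1 e (lazy_walk e a i) (lazy_walk e a j)
    <= (d i j)%:R + (1 - a) * (2 - 2 / deg i - 2 / deg j)
       + (1 - a) ^+ 2 * (2 / deg i + 2 / deg j).
Proof.
move=> a01 ij; have ji : j <> i by move/esym.
have deg_gt0 : 0 < deg i by rewrite ltr0n (degree_gt0 i j).
have degj_gt0 : 0 < deg j by rewrite ltr0n (degree_gt0 j i).
apply: le_trans (wasserstein1_le_product _ _ _ _ _ _ _ _ _) _.
- by move=> x; exact: lazy_walk_ge0.
- by move=> x; exact: lazy_walk_ge0.
- by apply: lazy_walk_mass => //; exact: degree_gt0 ij.
- by apply: lazy_walk_mass => //; exact: degree_gt0 ji.
have t_ge0 : 0 <= (1 - a) / deg j.
  by rewrite divr_ge0 // subr_ge0; case/andP: a01.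
(* The walker from [j] either stays, and then the mean distance is known exactly,
   or moves to some [x]; only in the latter case is the distance estimated. *)
rewrite lazy_walk_sum //.
under eq_bigr do rewrite (graph_distC _ _ conn_e sym_e j).
rewrite lazy_walk_sum_dist //.
have le_nbr x : e j x -> \sum_y lazy_walk e a i y 0 * (d x y)%:R <=
    a * (d x i)%:R + (1 - a) * ((d i j)%:R + 2).
  move=> ejx; rewrite lazy_walk_sum // lerD2l.
  have -> : (1 - a) * ((d i j)%:R + 2) =
      (1 - a) / deg i * \sum_(y | e i y) ((d i j)%:R + 2).
    by rewrite sum_neighbours_const; field; exact: lt0r_neq0.
  apply: ler_wpM2l; first by rewrite divr_ge0 // subr_ge0; case/andP: a01.
  apply: ler_sum => y eiy; rewrite -natrD ler_nat.
  have exj : e x j by rewrite sym_e.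
  have := graph_dist_triangle _ _ conn_e x j y.
  have := graph_dist_triangle _ _ conn_e j i y.
  have := graph_dist_edge _ _ _ _ exj; have := graph_dist_edge _ _ _ _ eiy.
  by rewrite (graph_distC _ _ conn_e sym_e j i); lia.
have := ler_wpM2l t_ge0 (ler_sum (index_enum _) le_nbr).
rewrite big_split /= -mulr_sumr sum_neighbour_dist // sum_neighbours_const.
rewrite (graph_distC _ _ conn_e sym_e j i) => sum_le.
apply: le_trans (lerD (lexx _) sum_le) _.
rewrite le_eqVlt; apply/orP; left; apply/eqP; field.
by rewrite !lt0r_neq0.
Qed.

End TreeWasserstein.

Theorem corollary3p6 (R : realType) (n : nat) (e : rel 'I_n) (i j : 'I_n)
    (tree_e : is_tree e) (neq_ij : i <> j) :
  cvg (lly_quotient e i j a @[a --> (1 : R)^'-]) /\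
  lly_curvature R e i j =
    2 / (graph_dist e i j)%:R
      * (1 / (degree e i)%:R + 1 / (degree e j)%:R - 1).
Proof.
set K : R := (2 / _ * _).
suff lim_K : lly_quotient e i j a @[a --> (1 : R)^'-] --> K.
  by split; [apply/cvg_ex; exists K | apply: cvg_lim].
have conn_e : graph_connected e by case: tree_e.
have D_gt0 : 0 < (graph_dist e i j)%:R :> R.
  by rewrite ltr0n lt0n; apply/eqP => /(graph_dist_eq0 _ _ conn_e).
set D : R := (graph_dist e i j)%:R in K D_gt0 *.
have ji : j <> i by move/esym.
have degi_gt0 : 0 < (degree e i)%:R :> R.
  by rewrite ltr0n (degree_gt0 _ _ tree_e i j).
have degj_gt0 : 0 < (degree e j)%:R :> R.
  by rewrite ltr0n (degree_gt0 _ _ tree_e j i).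
set u : R := 2 / (degree e i)%:R; set v : R := 2 / (degree e j)%:R.
have KE : K = (u + v - 2) / D by rewrite /K /u /v; field; rewrite !lt0r_neq0.
(* The excess [(1 - a) ^+ 2 * (u + v)] in the upper bound, divided by
   [D * (1 - a)]. *)
have near_lo : (K - (1 - a) * ((u + v) / D)) @[a --> (1 : R)^'-] --> K.
  apply: cvg_at_left_filter; rewrite -[X in _ --> X]subr0.
  apply: cvgB; first exact: cvg_cst.
  rewrite -[X in _ --> X](mul0r ((u + v) / D)); apply: cvgMl.
  by rewrite -[X in _ --> X](subrr (1 : R)); apply: cvgB; [exact: cvg_cst | exact: cvg_id].
apply: squeeze_cvgr near_lo (cvg_cst K).
near=> a.
have a_lt1 : a < 1 by near: a; exact: nbhs_left_lt.
have a_gt0 : 0 < a by near: a; exact: nbhs_left_gt.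
have a01 : 0 <= a <= 1 by rewrite !ltW.
have := wasserstein1_lazy_walk_ge R n e tree_e a i j a01 neq_ij.
have := wasserstein1_lazy_walk_le R n e tree_e a i j a01 neq_ij.
rewrite /lly_quotient /or_curvature -/D -/u -/v; set W := wasserstein1 _ _ _.
move=> W_le W_ge; have t_gt0 : 0 < 1 - a by rewrite subr_gt0.
have -> : (1 - W / D) / (1 - a) = (D - W) / (D * (1 - a)).
  by field; rewrite !lt0r_neq0.
rewrite KE ler_pdivlMr ?ler_pdivrMr ?mulr_gt0 //; apply/andP; split.
  have -> : ((u + v - 2) / D - (1 - a) * ((u + v) / D)) * (D * (1 - a)) =
      (u + v - 2) * (1 - a) - (1 - a) ^+ 2 * (u + v).
    by field; rewrite lt0r_neq0.
  lra.
have -> : (u + v - 2) / D * (D * (1 - a)) = (u + v - 2) * (1 - a).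
  by field; rewrite lt0r_neq0.
lra.
Unshelve. all: by end_near.
Qed.
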